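(* Let $F$ be a field and $m\ge1$ an integer, and if $F$ is finite assume $|F|\ge m+2$. The following are equivalent: (1) the binomial coefficients $\binom m0,\dots,\binom mm$ are all nonzero in $F$; (2) either $\mathrm{char}(F)=0$, or $\mathrm{char}(F)=p>0$ and $b<p$, where $m+1=p^ab$ with $b$ coprime to $p$; (3) the intersection of all osculating hyperplanes of $C_m$ at the points of $C_m(F)$ is empty; (4) $D_mV$ is an irreducible representation of $GL_2(F)$; (5) $D_mV$, $\mathrm{Sym}^mV$ and $\mathrm{Sym}^m(V^* )\otimes(\otimes^m\wedge^2V)$ are isomorphic as $GL_2(F)$-modules.
   Context: $V=F^2$ with basis $e_1,e_2$, $V^*$ with dual basis $X,Y$. $\mathrm{Sym}^mV$ has basis $e_1^{m-i}e_2^i$ with $g=\begin{pmatrix}a&b\\c&d\end{pmatrix}$ acting by $e_1^{m-i}e_2^i\mapsto(ae_1+be_2)^{m-i}(ce_1+de_2)^i$. $\mathrm{Sym}^m(V^* )$ is the space of binary forms of degree $m$ (basis $X^{m-i}Y^i$) with $g\cdot f(X,Y)=\det(g)^{-m}f(dX-bY,aY-cX)$. $D_mV=(\mathrm{Sym}^m(V^* ))^*$ with the dual (contragredient) action and basis $e_1^{[m-i]}e_2^{[i]}$ dual to $X^{m-i}Y^i$; in this basis $g$ acts by the matrix whose $(i,j)$ entry is the coefficient of $s^{m-j}t^j$ in $(as+bt)^{m-i}(cs+dt)^i$. $GL_2(F)$ acts on $\otimes^m\wedge^2V$ by $\det(g)^m$. $C_m\subset\mathbb{P}(D_mV)$ is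 the rational normal curve $\{\nu_m(s,t)=(s^m,s^{m-1}t,\dots,t^m)\}$ in coordinates $Q_0,\dots,Q_m$ w.r.t. the basis $e_1^{[m-i]}e_2^{[i]}$, and its osculating hyperplane at $\nu_m(s,t)$ is $\sum_{i=0}^m(-1)^i\binom mi t^{m-i}s^iQ_i=0$.
   Formalization: The printed action on Sym^m V reverses products (it is a right action, and (5) would fail for m=1); here g acts on Sym^m V by the standard left action e_1 -> a e_1 + c e_2, e_2 -> b e_1 + d e_2, i.e. the printed formula applied to the transpose of g. *)

(* Defs.v *)
From HB Require Import structures.
From mathcomp Require Import all_boot all_order all_algebra.
From mathcomp Require Import mpoly.

Set Implicit Arguments.
Unset Strict Implicit.
Unset Printing Implicit Defensive.

Import GRing.Theory.
Local Open Scope ring_scope.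

(* GL_2(F) is the set of [g : 'M[F]_2] with [g \in unitmx]; the value of
   [gl2_act] at a singular matrix is never used. *)
Record gl2_module (F : fieldType) := GL2Module {
  gl2_sort :> vectType F;
  gl2_act : 'M[F]_2 -> 'End(gl2_sort);
  gl2_act1 : gl2_act 1%:M = \1%VF;
  gl2_actM : forall g h : 'M[F]_2, g \in unitmx -> h \in unitmx ->
    gl2_act (g *m h) = (gl2_act g \o gl2_act h)%VF
}.

Definition gl2_stable (F : fieldType) (U : gl2_module F) (W : {vspace U}) :=
  forall g : 'M[F]_2, g \in unitmx -> forall u : U, u \in W -> gl2_act U g u \in W.

Definition gl2_irreducible (F : fieldType) (U : gl2_module F) : Prop :=
  (0 < \dim {:U})%N /\
  forall W : {vspace U}, gl2_stable W -> W = 0%VS \/ W = fullv.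

Definition gl2_iso (F : fieldType) (U W : gl2_module F) : Prop :=
  exists phi : 'Hom(U, W), bijective phi /\
    forall g : 'M[F]_2, g \in unitmx ->
      forall u : U, phi (gl2_act U g u) = gl2_act W g (phi u).

Lemma invmxM (R : comUnitRingType) n (A B : 'M[R]_n) :
  A \in unitmx -> B \in unitmx -> invmx (A *m B) = invmx B *m invmx A.
Proof.
move=> uA uB; have uAB : A *m B \in unitmx by rewrite unitmx_mul uA.
by apply: (can_inj (mulKmx uAB)); rewrite mulmxV // -mulmxA mulKVmx // mulmxV.
Qed.

Section Dual.
Variables (F : fieldType) (U : gl2_module F).

Definition dual_fun (g : 'M[F]_2) (lam : 'Hom(U, F^o)) : 'Hom(U, F^o) :=
  (lam \o gl2_act U (invmx g))%VF.

Fact dual_fun_is_linear g : linear (dual_fun g).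
Proof. by move=> c u v; rewrite /dual_fun comp_lfunDl comp_lfunZl. Qed.

HB.instance Definition _ g :=
  GRing.isLinear.Build F _ _ _ (dual_fun g) (dual_fun_is_linear g).

Fact dual_act1 : linfun (dual_fun 1%:M) = \1%VF.
Proof.
apply/lfunP => lam; rewrite lfunE id_lfunE /= /dual_fun.
by rewrite invmx1 gl2_act1 comp_lfun1r.
Qed.

Fact dual_actM (g h : 'M[F]_2) : g \in unitmx -> h \in unitmx ->
  linfun (dual_fun (g *m h)) = (linfun (dual_fun g) \o linfun (dual_fun h))%VF.
Proof.
move=> ug uh; apply/lfunP => lam; rewrite comp_lfunE !lfunE /= /dual_fun.
by rewrite invmxM // gl2_actM ?unitmx_inv // comp_lfunA.
Qed.

(* (g . lam)(u) = lam (g^-1 . u) *)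
Definition gl2_dual : gl2_module F := GL2Module dual_act1 dual_actM.

End Dual.

Section Twist.
Variables (F : fieldType) (U : gl2_module F) (k : nat).

Fact det_twist_act1 : (\det (1%:M : 'M[F]_2)) ^+ k *: gl2_act U 1%:M = \1%VF.
Proof. by rewrite det1 expr1n scale1r gl2_act1. Qed.

Fact det_twist_actM (g h : 'M[F]_2) : g \in unitmx -> h \in unitmx ->
  (\det (g *m h)) ^+ k *: gl2_act U (g *m h) =
  ((\det g ^+ k *: gl2_act U g) \o (\det h ^+ k *: gl2_act U h))%VF.
Proof.
move=> ug uh; rewrite gl2_actM // det_mulmx exprMn.
by rewrite -comp_lfunZr -comp_lfunZl scalerA mulrC.
Qed.

(* The tensor product of U with the line on which g acts by det(g)^k: tensoring
   with a line keeps the underlying space and multiplies the action by the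
   character. *)
Definition gl2_det_twist : gl2_module F :=
  GL2Module det_twist_act1 det_twist_actM.

End Twist.

Section BinaryForms.
Variable (F : fieldType).
Implicit Types (A B g h : 'M[F]_2).

Definition mx2 (a b c d : F) : 'M[F]_2 :=
  \matrix_(i, j) (if i == 0 then (if j == 0 then a else b)
                  else (if j == 0 then c else d)).

Definition rowform A (i : 'I_2) : {mpoly F[2]} :=
  A i 0 *: 'X_0 + A i 1 *: 'X_1.

Definition lin_subst A (f : {mpoly F[2]}) : {mpoly F[2]} :=
  f \mPo [tuple rowform A 0; rowform A 1].

Lemma tnth_rowform A i : tnth [tuple rowform A 0; rowform A 1] i = rowform A i.
Proof.
by case: i => [[|[|//]] lt_i]; rewrite (tnth_nth 0) /=; congr rowform;
  apply/val_inj.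
Qed.

Lemma rowform_homog A i : rowform A i \is 1.-homog.
Proof. by rewrite /rowform rpredD // rpredZ // dhomogX /= mdeg1. Qed.

Lemma lin_subst_homog m A (f : {mpoly F[2]}) :
  f \is m.-homog -> lin_subst A f \is m.-homog.
Proof.
move=> /dhomogP hf; rewrite /lin_subst comp_mpolyE big_seq.
apply: rpred_sum => mon /hf <-; rewrite rpredZ //= mdegE.
elim/big_ind2: _ => [|d1 p1 d2 p2 h1 h2|i _]; first exact: dhomog1.
  exact: dhomogM.
by rewrite tnth_rowform; have := dhomogMn (mon i) (rowform_homog A i); rewrite mul1n.
Qed.

Lemma lin_subst1 (f : {mpoly F[2]}) : lin_subst 1%:M f = f.
Proof.
rewrite -[RHS]comp_mpoly_id /lin_subst; congr (_ \mPo _).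
apply: eq_from_tnth => i; rewrite tnth_rowform tnth_mktuple /rowform !mxE.
by case: i => [[|[|//]] lt_i] /=; rewrite scale1r scale0r ?addr0 ?add0r;
  congr 'X_ _; apply/val_inj.
Qed.

Lemma lin_substM A B (f : {mpoly F[2]}) :
  lin_subst (A *m B) f = lin_subst B (lin_subst A f).
Proof.
rewrite /lin_subst [f \mPo [tuple rowform A 0; _]]comp_mpolyE raddf_sum /=.
rewrite comp_mpolyE; apply: eq_bigr => mon _.
rewrite comp_mpolyZ rmorph_prod /=; congr (_ *: _).
apply: eq_bigr => i _; rewrite rmorphXn /=; congr (_ ^+ _).
rewrite !tnth_rowform {2}/rowform comp_mpolyD !comp_mpolyZ !comp_mpolyXU /=.
rewrite /rowform !mxE !big_ord_recl !big_ord0 /= !addr0.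
have -> : lift ord0 ord0 = 1 :> 'I_2 by apply/val_inj.
rewrite !scalerDr !scalerA !scalerDl -!addrA; congr (_ + _).
by rewrite addrCA.
Qed.

Variable (m : nat).

Definition form_subst A (f : dhomog 2 F m) : dhomog 2 F m :=
  DHomog (lin_subst_homog A (dhomog_is_dhomog f)).

Fact form_subst_is_linear A : linear (form_subst A).
Proof.
move=> c f g; apply/val_inj => /=.
by rewrite /lin_subst raddfD /= comp_mpolyZ.
Qed.

HB.instance Definition _ A :=
  GRing.isLinear.Build F _ _ _ (form_subst A) (form_subst_is_linear A).

(* f(X, Y) |-> f(A 0 0 X + A 0 1 Y, A 1 0 X + A 1 1 Y) on forms of degree m *)
Definition form_end A : 'End(dhomog 2 F m) := linfun (form_subst A).

Lemma form_end1 : form_end 1%:M = \1%VF.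
Proof.
by apply/lfunP => f; apply/val_inj; rewrite lfunE id_lfunE /= lin_subst1.
Qed.

Lemma form_endM A B : form_end (A *m B) = (form_end B \o form_end A)%VF.
Proof.
apply/lfunP => f; apply/val_inj.
by rewrite comp_lfunE !lfunE /= lin_substM.
Qed.

Fact symV_act1 : form_end (1%:M)^T = \1%VF.
Proof. by rewrite trmx1 form_end1. Qed.

Fact symV_actM g h : g \in unitmx -> h \in unitmx ->
  form_end (g *m h)^T = (form_end g^T \o form_end h^T)%VF.
Proof. by move=> _ _; rewrite trmx_mul form_endM. Qed.

(* Sym^m V, as forms in (X_0, X_1) = (e_1, e_2).  For the dual of V to be V^*
   with g.X = det(g)^-1 (d X - b Y) and g.Y = det(g)^-1 (a Y - c X), g must act
   on V by e_1 |-> a e_1 + c e_2, e_2 |-> b e_1 + d e_2, that is, by the rows of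
   g^T.  The assignment e_1 |-> a e_1 + b e_2, e_2 |-> c e_1 + d e_2 (the rows
   of g) is the corresponding right action: it reverses products, and becomes
   this left action through g |-> g^T. *)
Definition symV : gl2_module F := GL2Module symV_act1 symV_actM.

Definition symVdual_act g : 'End(dhomog 2 F m) :=
  \det g ^- m *: form_end (mx2 (g 1 1) (- g 0 1) (- g 1 0) (g 0 0)).

Lemma mx2_invmx g : g \in unitmx ->
  mx2 (g 1 1) (- g 0 1) (- g 1 0) (g 0 0) = \det g *: invmx g.
Proof.
move=> ug; rewrite -[LHS]mul1mx -(mulVmx ug) -mulmxA.
rewrite -mul_mx_scalar; congr (_ *m _).
have o1 : lift ord0 ord0 = 1 :> 'I_2 by apply/val_inj.
apply/matrixP => i j; rewrite (expand_det_row g 0) !big_ord_recl !big_ord0 /=.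
rewrite /cofactor !det_mx11 !mxE !big_ord_recl !big_ord0 !mxE /= !o1.
have o2 : lift 1 ord0 = 0 :> 'I_2 by apply/val_inj.
rewrite !o2 !addr0 /= expr0 expr1 !mul1r mulN1r.
by case: i => [[|[|//]] lti]; case: j => [[|[|//]] ltj] /=;
  rewrite ?mulr1n ?mulr0n;
  (have -> : Ordinal lti = 0 :> 'I_2 by apply/val_inj) ||
  (have -> : Ordinal lti = 1 :> 'I_2 by apply/val_inj);
  rewrite ?mulrN ?(mulrC (g 1 1)) ?(mulrC (g 1 0)) ?[_ * g 0 0]mulrC
    ?[- _ + _]addrC ?subrr.
Qed.

Lemma form_endZ c A : form_end (c *: A) = c ^+ m *: form_end A.
Proof.
apply/lfunP => f; apply/val_inj; rewrite scale_lfunE !lfunE /= /lin_subst.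
rewrite !comp_mpolyE scaler_sumr big_seq [RHS]big_seq.
apply: eq_bigr => mon /(dhomog_mf (dhomog_is_dhomog f)) /= hm.
rewrite scalerA mulrC -scalerA; congr (_ *: _).
rewrite -hm mdegE -prodrXr -scaler_prod; apply: eq_bigr => i _.
rewrite !tnth_rowform -exprZn; congr (_ ^+ _).
by rewrite /rowform !mxE scalerDr !scalerA.
Qed.

Lemma symVdual_actE g : g \in unitmx -> symVdual_act g = form_end (invmx g).
Proof.
move=> ug; rewrite /symVdual_act mx2_invmx // form_endZ scalerA mulVf ?scale1r //.
by rewrite expf_neq0 // -unitfE -unitmxE.
Qed.

Fact symVdual_act1 : symVdual_act 1%:M = \1%VF.
Proof.
by rewrite symVdual_actE ?unitmx1 // invmx1 form_end1.
Qed.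

Fact symVdual_actM g h : g \in unitmx -> h \in unitmx ->
  symVdual_act (g *m h) = (symVdual_act g \o symVdual_act h)%VF.
Proof.
by move=> ug uh; rewrite !symVdual_actE ?unitmx_mul ?ug ?uh // invmxM // form_endM.
Qed.

(* Sym^m(V^* ): (g . f)(X, Y) = det(g)^-m f(d X - b Y, a Y - c X) *)
Definition symVdual : gl2_module F := GL2Module symVdual_act1 symVdual_actM.

(* D_m V = (Sym^m(V^* ))^* *)
Definition divV : gl2_module F := gl2_dual symVdual.

Fact monom_homog (i : 'I_m.+1) :
  'X_0 ^+ (m - i) * 'X_1 ^+ i \is [in F[2], m.-homog].
Proof.
have hX (j : 'I_2) k : 'X_j ^+ k \is [in F[2], k.-homog].
  have: 'X_j \is [in F[2], 1.-homog] by rewrite dhomogX /= mdeg1.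
  by move=> /(dhomogMn k); rewrite mul1n.
by have := dhomogM (hX 0 (m - i)%N) (hX 1 i); rewrite subnK ?leq_ord.
Qed.

Definition monom (i : 'I_m.+1) : dhomog 2 F m := DHomog (monom_homog i).

(* The coordinates Q_0, ..., Q_m on D_m V, with respect to the basis dual to
   the monomials X^(m-i) Y^i *)
Definition Qcoord (i : 'I_m.+1) (P : divV) : F := (P : 'Hom(symVdual, F^o)) (monom i).

Lemma form_monomE (f : dhomog 2 F m) :
  f = \sum_(j < m.+1) (val f)@_(U_(0%R) *+ (m - j) + U_(1%R) *+ j) *: monom j.
Proof.
apply/val_inj; rewrite raddf_sum /=; apply/mpolyP => mon.
have coefmon (j : 'I_m.+1) :
  (val (monom j))@_mon = ((U_(0%R) *+ (m - j) + U_(1%R) *+ j)%MM == mon)%:R.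
  by rewrite /= !mpolyXn -mpolyXD mcoeffX.
rewrite raddf_sum /=; under eq_bigr do rewrite linearZ /= coefmon.
have [degm|degm] := eqVneq (mdeg mon) m; last first.
  rewrite (dhomog_nemf_coeff (dhomog_is_dhomog f) degm) big1 // => j _.
  case: eqP => [eqm|]; last by rewrite mulr0.
  case/eqP: degm; rewrite -eqm mdegD !mdegMn !mdeg1 !mul1n subnK //.
  exact: leq_ord.
have mon1 : (mon 1%R < m.+1)%N.
  by rewrite ltnS -degm mdegE (bigD1 (1 : 'I_2)) //= leq_addr.
rewrite (bigD1 (Ordinal mon1)) //= big1 => [|j /eqP neq_j].
  have -> : (U_(0%R) *+ (m - mon 1%R) + U_(1%R) *+ mon 1%R)%MM = mon.
    apply/mnmP => i; rewrite mnmDE !mulmnE !mnm1E -degm mdegE.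
    rewrite !big_ord_recl big_ord0 addn0.
    have -> : lift ord0 ord0 = 1 :> 'I_2 by apply/val_inj.
    rewrite addnK; case: i => [[|[|//]] lti] /=.
      by rewrite mul1n mul0n addn0; congr (mon _); apply/val_inj.
    by rewrite mul1n mul0n add0n; congr (mon _); apply/val_inj.
  by rewrite eqxx mulr1 addr0.
case: eqP => [eqm|]; last by rewrite mulr0.
case: neq_j; apply/val_inj => /=.
by rewrite -eqm mnmDE !mulmnE !mnm1E /= mul0n mul1n.
Qed.

(* In the coordinates Q_i, g acts on D_m V by the matrix whose (i, j) entry is
   the coefficient of s^(m-j) t^j in (a s + b t)^(m-i) (c s + d t)^i. *)
Lemma Qcoord_act g (P : divV) (i : 'I_m.+1) : g \in unitmx ->
  Qcoord i (gl2_act divV g P) = \sum_(j < m.+1)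
    (rowform g 0 ^+ (m - i) * rowform g 1 ^+ i)
      @_(U_(0%R) *+ (m - j) + U_(1%R) *+ j) * Qcoord j P.
Proof.
move=> ug; have -> : gl2_act divV g P = dual_fun (U := symVdual) g P.
  exact: lfunE.
rewrite /Qcoord /dual_fun comp_lfunE /=.
rewrite symVdual_actE ?unitmx_inv // invmxK [form_end g _]form_monomE.
rewrite linear_sum /=; apply: eq_bigr => j _; rewrite linearZ /=; congr (_ * _).
by rewrite lfunE /= /lin_subst rmorphM !rmorphXn /= !comp_mpolyXU.
Qed.

(* The osculating hyperplane of C_m at nu_m(s, t) = (s^m, s^(m-1) t, ..., t^m),
   as a cone in D_m V *)
Definition osculating_hyperplane (s t : F) : pred divV := fun P =>
  \sum_(i < m.+1) (-1) ^+ i * 'C(m, i)%:R * t ^+ (m - i) * s ^+ i * Qcoord i P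
    == 0.

(* Points of P(D_m V) are nonzero vectors up to scaling; C_m(F) is the image of
   P^1(F) under nu_m. *)
Definition osculating_intersection_empty : Prop :=
  ~ exists2 P : divV, P != 0 &
      forall s t : F, (s, t) != (0, 0) -> P \in osculating_hyperplane s t.

End BinaryForms.

(* Main.v *)
(* The canonical equivariant map [dpow] : D_m V -> Sym^m V, v^[m] |-> v^m,
   multiplies the i-th coordinate by C(m, i), so its kernel is the intersection of
   the osculating hyperplanes.  A polynomial of degree at most m vanishing on F^*
   is zero because |F^*| > m; hence every stable subspace is a sum of weight lines
   of the torus diag(1, t), and the points of C_m(F) span D_m V.  If no binomial
   vanishes, a unipotent moves any weight vector to one with a nonzero coordinate
   on e_1^[m], which generates D_m V; if some binomial vanishes, [dpow], hence
   every homomorphism from D_m V to Sym^m V, has a kernel.  The arithmetic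
   criterion follows by comparing the p-adic valuations of k and m + 1 - k. *)
Require Import Defs.
From Stdlib Require Import Classical.
From HB Require Import structures.
From mathcomp Require Import all_boot all_order all_algebra.
From mathcomp Require Import mpoly.
Set Implicit Arguments.
Unset Strict Implicit.
Unset Printing Implicit Defensive.
Import GRing.Theory.
Local Open Scope ring_scope.

(** * Valuations of binomial coefficients at p *)

Section BinomialsModP.
Local Open Scope nat_scope.

Lemma logn_sub_lt p a b k : prime p -> coprime b p -> b < p ->
  0 < k < p ^ a * b -> logn p (p ^ a * b - k) = logn p k.
Proof.
move=> p_pr cobp ltbp /andP[k_gt0 ltk].
have b_gt0 : 0 < b by case: b ltk {cobp ltbp} => //; rewrite muln0 ltn0.
have pa_gt0 : 0 < p ^ a by rewrite expn_gt0 prime_gt0.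
have [k' cok' Dk] := pfactor_coprime p_pr k_gt0.
set c := logn p k in Dk *.
have logpM e u : coprime p u -> logn p (u * p ^ e) = e.
  move=> cou; have u_gt0 : 0 < u.
    case: u cou => //; rewrite /coprime gcdn0 => /eqP p1.
    by move: p_pr; rewrite p1.
  rewrite lognM //; last by rewrite expn_gt0 prime_gt0.
  by rewrite pfactorK // logn_coprime.
(* If c < a, dividing by p^c leaves p^(a-c) b - k', which is prime to p because p divides the first
   term but not k'. *)
have [ltca|leac] := ltnP c a.
  have -> : p ^ a * b - k = (p ^ (a - c) * b - k') * p ^ c.
    by rewrite mulnBl -Dk mulnAC -expnD subnK // ltnW.
  apply: logpM; rewrite prime_coprime //.
  have ltk' : k' < p ^ (a - c) * b.
    by rewrite -(ltn_pmul2r (m := p ^ c)) ?expn_gt0 ?prime_gt0 // -Dk mulnAC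
      -expnD subnK // ltnW.
  rewrite dvdn_subr ?(ltnW ltk') //; last first.
    by rewrite dvdn_mulr // dvdn_exp // subn_gt0.
  by rewrite -prime_coprime.
(* If a <= c, then k = l p^a with 0 < l < b < p, so l and b - l both lie strictly between 0 and p
   and are prime to p. *)
have Dk2 : k = (k' * p ^ (c - a)) * p ^ a by rewrite -mulnA -expnD subnK.
set l := k' * p ^ (c - a) in Dk2.
have ltlb : l < b by rewrite -(ltn_pmul2l pa_gt0) [X in X < _]mulnC -Dk2.
have l_gt0 : 0 < l by move: k_gt0; rewrite Dk2 muln_gt0 => /andP[].
have cop x : 0 < x < p -> coprime p x.
  by move=> /andP[x0 xp]; rewrite prime_coprime // gtnNdvd.
have -> : p ^ a * b - k = (b - l) * p ^ a by rewrite mulnBl -Dk2 mulnC.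
rewrite logpM; last first.
  by apply: cop; rewrite subn_gt0 ltlb (leq_ltn_trans (leq_subr _ _)).
by rewrite /c Dk2 logpM // cop // l_gt0 (ltn_trans ltlb).
Qed.

(* Consecutive binomials satisfy C(m, k) k = C(m, k-1) (m+1-k), so everything is
   decided by comparing the p-adic valuations of k and m+1-k. *)
Lemma ndvdn_bin p m a b i : prime p -> m + 1 = p ^ a * b -> coprime b p ->
  b < p -> i <= m -> ~~ (p %| 'C(m, i)).
Proof.
move=> p_pr Dm cobp ltbp.
suff H : i <= m -> logn p 'C(m, i) = 0.
  move=> leim; move: (H leim) => /eqP; rewrite -leqn0 leqNgt logn_gt0.
  by rewrite mem_primes p_pr bin_gt0 leim.
elim: i => [|i IHi] lti; first by rewrite bin0 logn1.
have := congr1 (logn p) (mul_bin_left m i).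
rewrite !lognM ?bin_gt0 ?subn_gt0 ?(ltnW lti) // IHi ?(ltnW lti) // addn0.
have -> : m - i = p ^ a * b - i.+1 by rewrite -Dm addn1 subSS.
rewrite logn_sub_lt -?Dm ?addn1 //.
by move/eqP; rewrite -[X in _ == X]addn0 eqn_add2l => /eqP.
Qed.

Lemma exists_dvdn_bin p m a b : prime p -> m + 1 = p ^ a * b -> p < b ->
  coprime b p -> exists2 i, i <= m & p %| 'C(m, i).
Proof.
move=> p_pr Dm ltpb cobp.
have p_gt0 := prime_gt0 p_pr.
have k_gt0 : 0 < p ^ a.+1 by rewrite expn_gt0 p_gt0.
have lekm : p ^ a.+1 <= m.
  by rewrite -ltnS -(addn1 m) Dm expnSr ltn_pmul2l ?expn_gt0 ?p_gt0.
have lekm' : (p ^ a.+1).-1 <= m by apply: leq_trans lekm; apply: leq_pred.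
(* With i + 1 = p^(a+1), the recurrence reads (i + 1) C(m, i+1) = p^a (b - p) C(m, i). As b - p is
   prime to p, the left factor has one more power of p, which C(m, i) must supply. *)
exists (p ^ a.+1).-1 => //.
have := congr1 (logn p) (mul_bin_left m (p ^ a.+1).-1).
have -> : m - (p ^ a.+1).-1 = p ^ a * (b - p).
  by rewrite mulnBr -expnSr -Dm addn1 -[in RHS](prednK k_gt0) subSS.
have bp_gt0 : 0 < b - p by rewrite subn_gt0.
rewrite prednK // !lognM ?muln_gt0 ?bin_gt0 ?expn_gt0 ?p_gt0 //.
rewrite !pfactorK // (@logn_coprime p (b - p)); last first.
  rewrite prime_coprime // dvdn_subl ?dvdnn ?(ltnW ltpb) //.
  by rewrite -prime_coprime // coprime_sym.
rewrite addn0 addSnnS => /eqP; rewrite eqn_add2l => /eqP h.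
have : 0 < logn p 'C(m, (p ^ a.+1).-1) by rewrite -h.
by rewrite logn_gt0 mem_primes => /and3P[].
Qed.

End BinomialsModP.

Lemma bin_neq0_pchar (F : fieldType) (m : nat) :
  (forall i : nat, (i <= m)%N -> 'C(m, i)%:R != 0 :> F) <->
  ([pchar F] =i pred0 \/
    exists p a b : nat, [/\ p \in [pchar F], (m + 1 = p ^ a * b)%N,
                            coprime b p & (b < p)%N]).
Proof.
split=> [bin_n0 | [F0 | [p [a [b [pF Dm cobp ltbp]]]]] i leim].
(* Excluded middle decides whether the characteristic is positive. *)
- have [[p pF]|noF] := classic (exists p, p \in [pchar F]); last first.
    by left=> p; apply/negP => pF; apply: noF; exists p.
  right; have p_pr := pcharf_prime pF.
  have m1_gt0 : (0 < m + 1)%N by rewrite addn1.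
  have [b copb Dm] := pfactor_coprime p_pr m1_gt0.
  rewrite coprime_sym in copb; rewrite mulnC in Dm.
  exists p, (logn p (m + 1)), b; split=> //.
  rewrite ltn_neqAle; apply/andP; split.
    apply/eqP => Db; move: copb; rewrite Db /coprime gcdnn => /eqP p1.
    by move: p_pr; rewrite p1.
  rewrite leqNgt; apply/negP => ltpb.
  have [i leim] := exists_dvdn_bin p_pr Dm ltpb copb.
  by rewrite (dvdn_pcharf pF); apply/negP/bin_n0.
- by move/pcharf0P: F0 => ->; rewrite -lt0n bin_gt0.
- rewrite -(dvdn_pcharf pF).
  exact: ndvdn_bin (pcharf_prime pF) Dm cobp ltbp leim.
Qed.

(** * Polynomial functions on the nonzero scalars *)

(** Expresses |F^*| >= n uniformly for finite and infinite F. *)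
Definition many_nonzero (F : fieldType) (n : nat) :=
  exists s : seq F, [/\ uniq s, size s = n & 0 \notin s].

Lemma many_nonzero_of_card (F : fieldType) (m : nat) :
  (forall e : seq F, Finite.axiom e -> (m + 2 <= size e)%N) -> many_nonzero F m.+1.
Proof.
move=> card_F.
suff: forall n, (n <= m.+1)%N -> many_nonzero F n by apply.
elim=> [|n IHn] ltn; first by exists [::].
have [s [us ss s0]] := IHn (ltnW ltn).
have [[x xs]|nox] := classic (exists x, x \notin 0 :: s).
  exists (x :: s); move: xs; rewrite inE negb_or => /andP[x0 xs].
  by rewrite /= xs us ss inE eq_sym negb_or x0.
(* If no further element exists, [0 :: s] enumerates F, so m + 2 <= n + 1, contrary to n <= m. *)
have ax : Finite.axiom (0 :: s).
  move=> x; rewrite count_uniq_mem /= ?s0 //.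
  by apply/eqP; rewrite eqb1; apply/negPn/negP => xs; apply: nox; exists x.
by have := card_F _ ax; rewrite /= ss addn2 !ltnS leqNgt ltn.
Qed.

Lemma poly_fun_eq0 (F : fieldType) (m : nat) (c : 'I_m.+1 -> F) :
  many_nonzero F m.+1 -> (forall t, t != 0 -> \sum_(j < m.+1) t ^+ j * c j = 0) ->
  forall j, c j = 0.
Proof.
move=> [s [us ss s0]] c0 j.
pose p := \poly_(i < m.+1) c (inord i).
suff p0 : p = 0.
  have := congr1 (fun q : {poly F} => q`_j) p0.
  by rewrite coef_poly ltn_ord coef0 inord_val.
apply: (roots_geq_poly_eq0 (rs := s)) => //; last first.
  by rewrite ss; apply: size_poly.
apply/allP => t ts; rewrite /root horner_poly.
under eq_bigr do rewrite inord_val mulrC.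
by rewrite c0 //; apply: contraNneq s0 => <-.
Qed.

(** Extracts weight components from a torus orbit. The map [pi] has kernel W, and each coordinate of
    [pi] applied to the sum is a scalar polynomial in t vanishing at all nonzero t. *)
Lemma poly_fun_mem (F : fieldType) (m : nat) (V : vectType F) (W : {vspace V})
    (v : 'I_m.+1 -> V) :
  many_nonzero F m.+1 ->
  (forall t, t != 0 -> \sum_(j < m.+1) t ^+ j *: v j \in W) ->
  forall j, v j \in W.
Proof.
move=> Fm vW j.
pose pi : 'End(V) := (\1 - projv W)%VF.
have piW u : u \in W -> pi u = 0.
  by move=> uW; rewrite /pi !lfun_simp projv_id // subrr.
suff pi0 : pi (v j) = 0.
  have -> : v j = projv W (v j).
    by apply/eqP; rewrite -subr_eq0 -pi0 /pi !lfun_simp.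
  exact: memv_proj.
rewrite (coord_vbasis (memvf (pi (v j)))) big1 // => k _.
suff -> : coord (vbasis fullv) k (pi (v j)) = 0 by rewrite scale0r.
apply: (poly_fun_eq0 (c := fun j => coord (vbasis fullv) k (pi (v j)))) => //.
move=> t t0; have := congr1 (coord (vbasis fullv) k) (piW _ (vW t t0)).
rewrite linear0 2!raddf_sum => h; rewrite -[RHS]h; apply: eq_bigr => i _.
by rewrite /= linearZ /= linearZ.
Qed.

Lemma poly_fun_vec_eq0 (F : fieldType) (m : nat) (V : vectType F)
    (v : 'I_m.+1 -> V) :
  many_nonzero F m.+1 ->
  (forall t, t != 0 -> \sum_(j < m.+1) t ^+ j *: v j = 0) ->
  forall j, v j = 0.
Proof.
move=> Fm v0 j; apply/eqP; rewrite -memv0.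
by apply: poly_fun_mem => // t /v0 ->; rewrite mem0v.
Qed.

(** * Coordinates on D_m V and the points of C_m *)

Section DividedPowers.
Variables (F : fieldType) (m : nat).
Implicit Types (P : divV F m) (g : 'M[F]_2) (f : dhomog 2 F m).

Definition form_coef (j : 'I_m.+1) f : F^o :=
  (val f)@_(U_(0%R) *+ (m - j) + U_(1%R) *+ j).

Fact form_coef_is_linear j : linear (form_coef j).
Proof. by move=> c f h; rewrite /form_coef /= mcoeffD mcoeffZ. Qed.

HB.instance Definition _ j :=
  GRing.isLinear.Build F _ _ _ (form_coef j) (form_coef_is_linear j).

Lemma form_coef_monom i j : form_coef j (monom F i) = (i == j)%:R.
Proof.
rewrite /form_coef /= !mpolyXn -mpolyXD mcoeffX; congr (_ %:R).
congr nat_of_bool; apply/eqP/eqP => [eqij|->//]; apply/val_inj.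
have := congr1 (fun mon : 'X_{1..2} => mon 1%R) eqij.
by rewrite !mnmDE !mulmnE !mnm1E /= !mul0n !mul1n !add0n.
Qed.

Lemma form_coef_sum f : f = \sum_(j < m.+1) form_coef j f *: monom F j.
Proof. exact: form_monomE. Qed.

(* The vector e_1^[m-j] e_2^[j] of D_m V. *)
Definition dmonom (j : 'I_m.+1) : divV F m := linfun (form_coef j).

Lemma Qcoord_is_linear i : linear (Qcoord i : divV F m -> F^o).
Proof.
by move=> c P P'; rewrite /Qcoord add_lfunE scale_lfunE.
Qed.

HB.instance Definition _ i :=
  GRing.isLinear.Build F _ _ _ (Qcoord i : divV F m -> F^o) (Qcoord_is_linear i).

Lemma Qcoord_dmonom i j : Qcoord i (dmonom j) = (i == j)%:R.
Proof. by rewrite /Qcoord lfunE /= form_coef_monom. Qed.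

Lemma Qcoord_inj P P' : (forall i, Qcoord i P = Qcoord i P') -> P = P'.
Proof.
move=> eqQ; apply/lfunP => f; rewrite (form_coef_sum f) !linear_sum.
by apply: eq_bigr => j _; rewrite !linearZ; congr (_ *: _); apply: eqQ.
Qed.

Lemma Qcoord_sum (c : 'I_m.+1 -> F) i :
  Qcoord i (\sum_(j < m.+1) c j *: dmonom j) = c i.
Proof.
rewrite linear_sum (bigD1 i) //= big1 => [|j neq_ji].
  by rewrite linearZ /= Qcoord_dmonom eqxx addr0 [_ *: _]mulr1.
by rewrite linearZ /= Qcoord_dmonom eq_sym (negPf neq_ji) [_ *: _]mulr0.
Qed.

Lemma dmonom_sum P : P = \sum_(j < m.+1) Qcoord j P *: dmonom j.
Proof. by apply: Qcoord_inj => i; rewrite Qcoord_sum. Qed.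

Lemma dmonom_neq0 j : dmonom j != 0.
Proof.
apply/eqP => /(congr1 (Qcoord j)); rewrite Qcoord_dmonom eqxx [RHS]linear0.
exact/eqP/oner_neq0.
Qed.

Definition nu (s t : F) : divV F m :=
  \sum_(j < m.+1) (s ^+ (m - j) * t ^+ j) *: dmonom j.

Definition pt2 (s t : F) (i : 'I_2) : F := if i == 0 then s else t.

Lemma nuE s t f : (nu s t : 'Hom(symVdual F m, F^o)) f = (val f).@[pt2 s t].
Proof.
rewrite {2}(form_coef_sum f) raddf_sum rmorph_sum sum_lfunE /=.
apply: eq_bigr => j _; rewrite scale_lfunE lfunE /= mevalZ.
by rewrite rmorphM !rmorphXn /= !mevalXU [RHS]mulrC.
Qed.

(** The inverse in the contragredient action cancels the one in the action on forms. *)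
Lemma act_divVE g P f : g \in unitmx ->
  (gl2_act (divV F m) g P : 'Hom(symVdual F m, F^o)) f =
  (P : 'Hom(symVdual F m, F^o)) (form_end m g f).
Proof.
move=> ug; have -> : gl2_act (divV F m) g P = dual_fun (U := symVdual F m) g P.
  exact: lfunE.
by rewrite /dual_fun comp_lfunE /= symVdual_actE ?unitmx_inv // invmxK.
Qed.

(** By [nuE], [nu s t] is evaluation of forms at (s, t), and evaluating after the substitution g is
    evaluating at the image point. *)
Lemma act_nu g s t : g \in unitmx ->
  gl2_act (divV F m) g (nu s t) =
  nu (g 0 0 * s + g 0 1 * t) (g 1 0 * s + g 1 1 * t).
Proof.
move=> ug; apply/lfunP => f; rewrite act_divVE // !nuE lfunE /=.
rewrite comp_mpoly_meval; apply: meval_eq => i.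
rewrite tnth_rowform /rowform mevalD !mevalZ !mevalXU.
by case: i => [[|[|//]] lti]; rewrite /pt2 /=; congr (g _ _ * _ + g _ _ * _);
  apply/val_inj.
Qed.

Lemma nu10 : nu 1 0 = dmonom 0.
Proof.
apply: Qcoord_inj => i; rewrite Qcoord_sum Qcoord_dmonom expr1n mul1r expr0n.
by [].
Qed.

Lemma nu1E c : nu 1 c = \sum_(j < m.+1) c ^+ j *: dmonom j.
Proof. by apply: eq_bigr => j _; rewrite expr1n mul1r. Qed.

Lemma unitmx2 (g : 'M[F]_2) :
  (g \in unitmx) = (g 0 0 * g 1 1 - g 0 1 * g 1 0 != 0).
Proof.
have o1 : lift ord0 ord0 = 1 :> 'I_2 by apply/val_inj.
have o2 : lift 1 ord0 = 0 :> 'I_2 by apply/val_inj.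
rewrite unitmxE unitfE (expand_det_row g 0) !big_ord_recl big_ord0 /=.
rewrite /cofactor !det_mx11 !mxE /= !o1 o2 expr0 expr1 mul1r mulN1r addr0.
by rewrite mulrN.
Qed.

Lemma mx2E (a b c d : F) : (mx2 a b c d 0 0 = a) * (mx2 a b c d 0 1 = b) *
  (mx2 a b c d 1 0 = c) * (mx2 a b c d 1 1 = d).
Proof. by rewrite !mxE. Qed.

End DividedPowers.

(** * The map from D_m V to Sym^m V and its consequences *)

Section DividedToSymmetric.
Variables (F : fieldType) (m : nat).
Implicit Types (P : divV F m) (g : 'M[F]_2) (f : dhomog 2 F m).

Definition dpow_fun P : symV F m :=
  \sum_(j < m.+1) ('C(m, j)%:R * Qcoord j P) *: monom F j.

Fact dpow_fun_is_linear : linear dpow_fun.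
Proof.
move=> c P P'; rewrite /dpow_fun scaler_sumr -big_split /=.
apply: eq_bigr => j _; rewrite scalerA -scalerDl; congr (_ *: _).
by rewrite linearP /= mulrDr [_ *: _]/(_ * _) mulrCA.
Qed.

HB.instance Definition _ :=
  GRing.isLinear.Build F _ _ _ dpow_fun dpow_fun_is_linear.

(* The canonical map D_m V -> Sym^m V, sending v^[m] to v^m. *)
Definition dpow : 'Hom(divV F m, symV F m) := linfun dpow_fun.

Lemma dpowE P :
  dpow P = \sum_(j < m.+1) ('C(m, j)%:R * Qcoord j P) *: monom F j.
Proof. exact: lfunE. Qed.

Lemma dpow_dmonom j : dpow (dmonom F j) = 'C(m, j)%:R *: monom F j.
Proof.
rewrite dpowE (bigD1 j) //= big1 => [|i neq_ij].
  by rewrite Qcoord_dmonom eqxx mulr1 addr0.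
by rewrite Qcoord_dmonom (negPf neq_ij) mulr0 scale0r.
Qed.

Lemma form_coef_dpow j P : form_coef j (dpow P) = 'C(m, j)%:R * Qcoord j P.
Proof.
rewrite dpowE linear_sum (bigD1 j) //= big1 => [|i neq_ij].
  by rewrite linearZ /= form_coef_monom eqxx addr0 [_ *: _]mulr1.
by rewrite linearZ /= form_coef_monom (negPf neq_ij) [_ *: _]mulr0.
Qed.

(** The binomial theorem; it accounts for the factors C(m, j) in [dpow]. *)
Lemma val_dpow_nu s t :
  val (dpow (nu m s t) : dhomog 2 F m) = (s *: 'X_0 + t *: 'X_1) ^+ m.
Proof.
rewrite dpowE raddf_sum exprDn; apply: eq_bigr => j _ /=.
rewrite Qcoord_sum !exprZn -scalerAl -scalerAr !scalerA -scaler_nat scalerA.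
by [].
Qed.

Lemma val_symV_act g f : val (gl2_act (symV F m) g f : dhomog 2 F m) =
  lin_subst g^T (val f).
Proof. by rewrite /= lfunE. Qed.

Hypothesis Fm : many_nonzero F m.+1.

(* The points of C_m(F) span D_m V. *)
Lemma divV_hom_eq (V : vectType F) (a b : 'Hom(divV F m, V)) :
  (forall t, a (nu m 1 t) = b (nu m 1 t)) -> a = b.
Proof.
move=> eqab; apply/lfunP => P; rewrite (dmonom_sum P) !linear_sum.
apply: eq_bigr => j _; rewrite !linearZ; congr (_ *: _).
apply/eqP; rewrite -subr_eq0; apply/eqP.
apply: (poly_fun_vec_eq0 (v := fun j => a (dmonom F j) - b (dmonom F j))) => //.
move=> t _; under eq_bigr do rewrite scalerBr -!linearZ.
by rewrite sumrB -!linear_sum /= -nu1E eqab subrr.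
Qed.

(** It suffices to compare on the spanning vectors [nu m 1 t], where both sides are the m-th power
    of the same linear form. *)
Lemma dpow_equivariant g P : g \in unitmx ->
  dpow (gl2_act (divV F m) g P) = gl2_act (symV F m) g (dpow P).
Proof.
move=> ug; rewrite -!comp_lfunE; congr (fun_of_lfun _ P).
apply: divV_hom_eq => t; rewrite !comp_lfunE act_nu //.
apply/val_inj; rewrite val_dpow_nu val_symV_act val_dpow_nu.
rewrite /lin_subst rmorphXn /= comp_mpolyD !comp_mpolyZ !comp_mpolyXU /=.
rewrite /rowform !mxE !scalerDr !scalerA !scalerDl !mulr1 !(mulrC t).
by rewrite !mul1r addrACA.
Qed.

(** The kernel of [dpow] is stable. It contains the i-th basis vector when C(m, i) = 0, but never
    e_1^[m], since C(m, 0) = 1. *)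
Lemma bin_neq0_of_irreducible : gl2_irreducible (divV F m) ->
  forall i, (i <= m)%N -> 'C(m, i)%:R != 0 :> F.
Proof.
move=> [_ irr] i leim; apply/eqP => bin0.
have : gl2_stable (lker dpow).
  move=> g ug u; rewrite !memv_ker => /eqP u0.
  by rewrite dpow_equivariant // u0 linear0.
case/irr => kerE.
  have : dmonom F (Ordinal (leim : (i < m.+1)%N)) \in lker dpow.
    by rewrite memv_ker dpow_dmonom /= bin0 scale0r.
  by rewrite kerE memv0 (negPf (dmonom_neq0 _ _)).
have : dmonom F (0 : 'I_m.+1) \in lker dpow by rewrite kerE memvf.
rewrite memv_ker dpow_dmonom /= binomial.bin0 scale1r => /eqP.
move/(congr1 (@form_coef F m 0)); rewrite form_coef_monom eqxx linear0.
exact/eqP/oner_neq0.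
Qed.

Lemma unitmx_mx2 (a b c d : F) : (mx2 a b c d \in unitmx) = (a * d - b * c != 0).
Proof. by rewrite unitmx2 !mx2E. Qed.

Lemma form_end_diag_monom (t : F) j :
  form_end m (mx2 1 0 0 t) (monom F j) = t ^+ j *: monom F j.
Proof.
apply/val_inj; rewrite lfunE /= /lin_subst rmorphM !rmorphXn /= !comp_mpolyXU /=.
rewrite /rowform !mx2E !scale0r scale1r addr0 add0r exprZn -scalerAr.
by [].
Qed.

Lemma form_end_diag t f :
  form_end m (mx2 1 0 0 t) f =
  \sum_(j < m.+1) t ^+ j *: (form_coef j f *: monom F j).
Proof.
rewrite {1}(form_coef_sum f) linear_sum; apply: eq_bigr => j _.
by rewrite linearZ /= form_end_diag_monom !scalerA mulrC.
Qed.

Lemma unitmx_diag (t : F) : t != 0 -> mx2 1 0 0 t \in unitmx.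
Proof. by rewrite unitmx_mx2 mul1r mul0r subr0. Qed.

Lemma diag_divV t P : t != 0 ->
  gl2_act (divV F m) (mx2 1 0 0 t) P =
  \sum_(j < m.+1) t ^+ j *: (Qcoord j P *: dmonom F j).
Proof.
move=> t0; apply: Qcoord_inj => i; under eq_bigr do rewrite scalerA.
rewrite Qcoord_sum /Qcoord act_divVE ?unitmx_diag // form_end_diag_monom.
by rewrite linearZ.
Qed.

(** The image of P under diag(1, t) is a polynomial in t whose coefficients are the weight
    components of P, so [poly_fun_mem] isolates each one. *)
Lemma stable_dmonom (W : {vspace divV F m}) P j : gl2_stable W -> P \in W ->
  Qcoord j P != 0 -> dmonom F j \in W.
Proof.
move=> sW PW Qj; have : Qcoord j P *: dmonom F j \in W.
  apply: (poly_fun_mem (v := fun j => Qcoord j P *: dmonom F j)) => // t t0.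
  by rewrite -diag_divV //; apply: sW; rewrite ?unitmx_diag.
by rewrite rpredZeq (negPf Qj).
Qed.

Lemma irreducible_of_bin_neq0 :
  (forall i, (i <= m)%N -> 'C(m, i)%:R != 0 :> F) -> gl2_irreducible (divV F m).
Proof.
move=> bin_n0; split.
  rewrite lt0n dimv_eq0; apply/eqP => full0.
  have := memvf (dmonom F (0 : 'I_m.+1)).
  by rewrite full0 memv0 (negPf (dmonom_neq0 _ _)).
move=> W sW; have [->|/eqP W0] := eqVneq W 0%VS; [by left | right].
have [P PW P0] : exists2 P, P \in W & P != 0.
  exists (vpick W); first exact: memv_pick.
  by rewrite vpick0; apply/eqP.
have [j Qj] : exists j, Qcoord j P != 0.
  apply/existsP; apply: contraNT P0; rewrite negb_exists => /forallP Q0.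
  apply/eqP/Qcoord_inj => i; rewrite [RHS]linear0.
  by apply/eqP; rewrite -[_ == _]negbK Q0.
have jW := stable_dmonom sW PW Qj.
have uU : mx2 (1 : F) 1 0 1 \in unitmx.
  by rewrite unitmx_mx2 !mulr1 mulr0 subr0 oner_neq0.
(* The coordinate Q_0 of the unipotent image of the j-th basis vector is the coefficient of X^(m-j)
   Y^j in (X + Y)^m, that is C(m, j). *)
have W00 : dmonom F (0 : 'I_m.+1) \in W.
  apply: (stable_dmonom sW (sW _ uU _ jW)).
  rewrite /Qcoord act_divVE // lfunE /= /form_coef lfunE /= /lin_subst.
  rewrite expr0 mulr1 subn0 rmorphXn /= comp_mpolyXU /= /rowform !mx2E.
  rewrite -val_dpow_nu -[X in X != 0]/(form_coef j (dpow (nu m 1 1))).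
  rewrite form_coef_dpow Qcoord_sum !expr1n !mulr1.
  by apply: bin_n0; rewrite -ltnS.
(* Opposite unipotents carry e_1^[m] to [nu m 1 t], whose coefficients in t are all the basis
   vectors. *)
have allW i : dmonom F i \in W.
  apply: (poly_fun_mem (v := @dmonom F m)) => // t t0.
  have uL : mx2 1 0 t 1 \in unitmx.
    by rewrite unitmx_mx2 mulr1 mul0r subr0 oner_neq0.
  have := sW _ uL _ W00; rewrite -nu10 act_nu // !mx2E !mulr0 !mulr1 !addr0.
  by rewrite nu1E.
apply/vspaceP => Q; rewrite memvf (dmonom_sum Q).
by apply: memv_suml => i _; apply: (memvZ _ (allW i)).
Qed.

Lemma osculating_of_bin_neq0 :
  (forall i, (i <= m)%N -> 'C(m, i)%:R != 0 :> F) ->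
  osculating_intersection_empty F m.
Proof.
move=> bin_n0 [P /eqP P0 oscP]; apply/P0/Qcoord_inj => i; rewrite [RHS]linear0.
(* At the points (s, 1) the osculating equation is a polynomial in s of degree at most m. *)
have H (j : 'I_m.+1) : (-1) ^+ j * 'C(m, j)%:R * Qcoord j P = 0.
  apply: (poly_fun_eq0
    (c := fun j : 'I_m.+1 => (-1) ^+ j * 'C(m, j)%:R * Qcoord j P)) => // s _.
  have s1 : (s, 1) != (0, 0) :> F * F.
    by rewrite xpair_eqE oner_eq0 andbF.
  have /eqP h := oscP s 1 s1; rewrite -[RHS]h; apply: eq_bigr => k _.
  by rewrite expr1n mulr1 mulrCA mulrA.
have bini : 'C(m, i)%:R != 0 :> F by apply: bin_n0; rewrite -ltnS.
move: (H i) => /eqP.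
by rewrite mulf_eq0 mulf_eq0 signr_eq0 (negPf bini) => /eqP.
Qed.

(** If C(m, i) = 0, then Q_i drops out of every osculating equation, so the i-th basis vector lies
    on all these hyperplanes. *)
Lemma bin_neq0_of_osculating : osculating_intersection_empty F m ->
  forall i, (i <= m)%N -> 'C(m, i)%:R != 0 :> F.
Proof.
move=> osc i leim; apply/eqP => bin0; apply: osc.
exists (dmonom F (Ordinal (leim : (i < m.+1)%N))); first exact: dmonom_neq0.
move=> s t _; apply/eqP; apply: big1 => j _; rewrite Qcoord_dmonom.
by have [->|_] := eqVneq; rewrite ?mulr0 //= bin0 mulr0 !mul0r.
Qed.

Lemma divV_iso_symV : (forall i, (i <= m)%N -> 'C(m, i)%:R != 0 :> F) ->
  gl2_iso (divV F m) (symV F m).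
Proof.
move=> bin_n0; exists dpow; split; last by move=> g ug u; apply: dpow_equivariant.
have binj (j : 'I_m.+1) : 'C(m, j)%:R != 0 :> F by apply: bin_n0; rewrite -ltnS.
exists (fun f =>
  \sum_(j < m.+1) (('C(m, j)%:R : F)^-1 * (form_coef j f : F)) *: dmonom F j).
  move=> P; apply: Qcoord_inj => i.
  by rewrite Qcoord_sum form_coef_dpow; apply: (mulKf (binj i)).
move=> f; rewrite dpowE [RHS]form_coef_sum; apply: eq_bigr => j _.
by rewrite Qcoord_sum (mulVKf (binj j)).
Qed.

(* Fixed by diag(1, t), the image of e_1^[m] is a multiple k e_1^m; moving it by
   unipotents gives [theta] = k [dpow], which is injective only if no binomial
   vanishes. *)
Lemma bin_neq0_of_iso : gl2_iso (divV F m) (symV F m) ->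
  forall i, (i <= m)%N -> 'C(m, i)%:R != 0 :> F.
Proof.
move=> [theta [/bij_inj theta_inj thetaE]] i leim; apply/eqP => bin0.
pose f : dhomog 2 F m := theta (dmonom F 0).
pose k : F := form_coef 0 f.
have fE : f = k *: monom F 0.
  (* These are the coefficients in t of the image of f under diag(1, t), minus f. The difference
     vanishes for all nonzero t, and its constant term gives the claim. *)
  pose v (j : 'I_m.+1) : dhomog 2 F m :=
    (form_coef j f : F) *: monom F j - (j == 0)%:R *: f.
  have : v 0 = 0.
    apply: (poly_fun_vec_eq0 (v := v)) => // t t0.
    have fixf : form_end m (mx2 1 0 0 t) f = f.
      have trd : (mx2 1 0 0 t)^T = mx2 1 0 0 t.
        by apply/matrixP => a b; rewrite !mxE; case: eqP; case: eqP.
      have := thetaE _ (unitmx_diag t0) (dmonom F 0).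
      rewrite -nu10 act_nu ?unitmx_diag // !mx2E !mulr0 !mulr1 !addr0 nu10.
      by rewrite -/f /= trd => {2}->.
    transitivity (form_end m (mx2 1 0 0 t) f - f); last by rewrite fixf subrr.
    rewrite form_end_diag /v; under eq_bigr do rewrite scalerBr.
    rewrite sumrB; congr (_ - _).
    rewrite (bigD1 0) //= big1 => [|j /negPf->]; last by rewrite scale0r scaler0.
    by rewrite expr0 !scale1r addr0.
  by rewrite /v eqxx scale1r => /eqP; rewrite subr_eq0 => /eqP.
have thetaD : theta = k *: dpow.
  apply: divV_hom_eq => t; rewrite scale_lfunE.
  have uL : mx2 1 0 t 1 \in unitmx.
    by rewrite unitmx_mx2 mulr1 mul0r subr0 oner_neq0.
  have := thetaE _ uL (dmonom F 0).
  have -> : gl2_act (divV F m) (mx2 1 0 t 1) (dmonom F 0) = nu m 1 t.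
    by rewrite -nu10 act_nu // !mx2E !mulr0 !mulr1 !addr0.
  move=> ->; rewrite -/f fE linearZ /=; congr (_ *: _).
  have -> : monom F (0 : 'I_m.+1) = dpow (dmonom F 0).
    by rewrite dpow_dmonom binomial.bin0 scale1r.
  rewrite -[form_end _ _ _]/(gl2_act (symV F m) (mx2 1 0 t 1) _).
  rewrite -dpow_equivariant // -nu10 act_nu // !mx2E.
  by rewrite !mulr0 !mulr1 !addr0.
case/eqP: (dmonom_neq0 F (Ordinal (leim : (i < m.+1)%N))); apply: theta_inj.
by rewrite linear0 thetaD scale_lfunE dpow_dmonom /= bin0 scale0r scaler0.
Qed.

End DividedToSymmetric.

(* Conjugation by J = mx2 0 1 (-1) 0 turns the adjugate of g into its transpose. *)
Lemma symV_iso_twist (F : fieldType) (m : nat) :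
  gl2_iso (symV F m) (gl2_det_twist (symVdual F m) m).
Proof.
pose J : 'M[F]_2 := mx2 0 1 (-1) 0.
pose J' : 'M[F]_2 := mx2 0 (-1) 1 0.
have o1 : lift ord0 ord0 = 1 :> 'I_2 by apply/val_inj.
have JJ' : J *m J' = 1%:M /\ J' *m J = 1%:M.
  split; apply/matrixP => i j; rewrite !mxE !big_ord_recl !big_ord0 !mxE.
    by case: i => [[|[|//]] ?]; case: j => [[|[|//]] ?];
      rewrite /= ?(mulr0, mul0r, mulr1, mul1r, mulrN1, opprK, addr0, add0r, oppr0).
  by case: i => [[|[|//]] ?]; case: j => [[|[|//]] ?];
    rewrite /= ?(mulr0, mul0r, mulr1, mul1r, mulrN1, opprK, addr0, add0r, oppr0).
exists (form_end m J); split.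
  case: JJ' => JJ' J'J.
  exists (form_end m J') => f.
    by rewrite -comp_lfunE -form_endM JJ' form_end1 id_lfunE.
  by rewrite -comp_lfunE -form_endM J'J form_end1 id_lfunE.
move=> g ug f.
have detg : \det g ^+ m != 0 by rewrite expf_neq0 // -unitfE -unitmxE.
(* The twist cancels det(g)^-m, leaving substitution by the adjugate; what remains is g^T J = J
   adj(g). *)
rewrite /= /symVdual_act scalerA mulfV // scale1r -!comp_lfunE -!form_endM.
congr (form_end m _ f); apply/matrixP => i j.
rewrite !mxE !big_ord_recl !big_ord0 !mxE !o1.
by case: i => [[|[|//]] ?]; case: j => [[|[|//]] ?];
  rewrite /= ?(mulr0, mul0r, mulr1, mul1r, mulrN1, mulN1r, opprK, addr0, add0r);
  try congr (- _); congr (g _ _); apply/val_inj.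
Qed.

(** * Composing isomorphisms and closing the cycle of equivalences *)

Lemma gl2_iso_trans (F : fieldType) (U V W : gl2_module F) :
  gl2_iso U V -> gl2_iso V W -> gl2_iso U W.
Proof.
move=> [a [bij_a aE]] [b [bij_b bE]]; exists (b \o a)%VF; split.
  have eqba : b \o a =1 (b \o a)%VF by move=> u; rewrite comp_lfunE.
  exact: eq_bij (bij_comp bij_b bij_a) _ eqba.
by move=> g ug u; rewrite !comp_lfunE aE // bE.
Qed.

Theorem theoremA2 (F : fieldType) (m : nat) (m_ge1 : (1 <= m)%N)
    (card_F : forall e : seq F, Finite.axiom e -> (m + 2 <= size e)%N) :
  [<-> forall i : nat, (i <= m)%N -> 'C(m, i)%:R != 0 :> F;
       [pchar F] =i pred0 \/
         exists p a b : nat, [/\ p \in [pchar F], (m + 1 = p ^ a * b)%N,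
                                coprime b p & (b < p)%N];
       osculating_intersection_empty F m;
       gl2_irreducible (divV F m);
       [/\ gl2_iso (divV F m) (symV F m),
           gl2_iso (divV F m) (gl2_det_twist (symVdual F m) m)
         & gl2_iso (symV F m) (gl2_det_twist (symVdual F m) m)]].
Proof.
have Fm := many_nonzero_of_card card_F; have charE := bin_neq0_pchar F m.
tfae.
(* The implications form a cycle, each passing through the non-vanishing of the binomials. *)
- by move/charE.
- by move/charE; apply: osculating_of_bin_neq0.
- by move/bin_neq0_of_osculating; apply: irreducible_of_bin_neq0.
- move/(bin_neq0_of_irreducible Fm)/(divV_iso_symV Fm) => iso.
  have tw := symV_iso_twist F m.
  by split=> //; apply: gl2_iso_trans iso tw.
- by case=> /(bin_neq0_of_iso Fm).
Qed.
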